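(* Let $\mathcal C,\mathcal D$ be finite stable configuration structures. Then $\mathcal C$ and $\mathcal D$ are hereditary history-preserving (HH) bisimilar if and only if $\mathcal C$ and $\mathcal D$ satisfy the same closed EIL formulas of modal depth at most $s(\mathcal C,\mathcal D)+c(\mathcal C,\mathcal D)$.
   Context: Configuration structures. A configuration structure over $\mathsf{Act}$ is $\mathcal C=(C_{\mathcal C},\ell_{\mathcal C})$, $C_{\mathcal C}$ a family of finite sets (configurations), $\ell:\bigcup C_{\mathcal C}\to\mathsf{Act}$, events $E_{\mathcal C}=\bigcup C_{\mathcal C}$; finite means $C_{\mathcal C}$ finite. Stable: $\emptyset\in C$; every nonempty $X\in C$ has $e\in X$ with $X\setminus\{e\}\in C$; for $X,Y,Z\in C$ with $X\cup Y\subseteq Z$, $X\cup Y\in C$ and $X\cap Y\in C$. For $X\in C$: $d\le_Xe$ iff every $Y\in C$ with $Y\subseteq X$, $e\in Y$ contains $d$; $d<_Xe$ iff $d\le_Xe$, $d\ne e$. $X\xrightarrow{e}X'$ iff $X,X'\in C$, $X\subseteq X'$, $X'\setminus X=\{e\}$; $X\xrightarrow{a}X'$ iff this holds with $\ell(e)=a$. $f:X\cong Y$ means $f$ is a label-preserving bijection with $d<_Xe\iff f(d)<_Yf(e)$. $s(\mathcal C,\mathcal D)$ is the number of triples $(X,Y,f)$ with $X\in C_{\mathcal C}$, $Y\in C_{\mathcal D}$, $f:X\cong Y$; $c(\mathcal C)=\max\{|X|:X\in C_{\mathcal C}\}$, $c(\mathcal C,\mathcal D)=\min\{c(\mathcal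 C),c(\mathcal D)\}$. HH bisimulation: $\mathcal R\subseteq C_{\mathcal C}\times C_{\mathcal D}\times\mathcal P(E_{\mathcal C}\times E_{\mathcal D})$ with $\mathcal R(\emptyset,\emptyset,\emptyset)$ such that whenever $\mathcal R(X,Y,f)$, $a\in\mathsf{Act}$: $f:X\cong Y$; if $X\xrightarrow{a}X'$ then $\exists Y',f'$ with $Y\xrightarrow{a}Y'$, $\mathcal R(X',Y',f')$, $f'\restriction X=f$, and symmetrically; if $X'\xrightarrow{a}X$ then $\exists Y',f'$ with $Y'\xrightarrow{a}Y$, $\mathcal R(X',Y',f')$, $f\restriction X'=f'$, and symmetrically. EIL. Syntax $\phi::=\mathrm{tt}\mid\neg\phi\mid\phi\wedge\phi'\mid\langle x:a\rangle\phi\mid(x:a)\phi\mid\langle\!\langle x\rangle\!\rangle\phi$; $\langle x:a\rangle,(x:a)$ bind $x$; $\mathrm{fi}(\langle\!\langle x\rangle\!\rangle\phi)=\mathrm{fi}(\phi)\cup\{x\}$, other clauses as usual; closed = no free identifiers. Environment $\rho$ (partial map identifiers $\to$ events) permissible for $\phi$ and $X$: $\mathrm{fi}(\phi)\subseteq\mathrm{dom}\rho$, $\rho(\mathrm{fi}(\phi))\subseteq X$. Semantics: $\mathrm{tt},\neg,\wedge$ classical; $X,\rho\models\langle x:a\rangle\phi$ iff $\exists X',e$: $X\xrightarrow{e}X'$, $\ell(e)=a$, $X',\rho[x\mapsto e]\models\phi$; $X,\rho\models(x:a)\phi$ iff $\exists e\in X$, $\ell(e)=a$, $X,\rho[x\mapsto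 e]\models\phi$; $X,\rho\models\langle\!\langle x\rangle\!\rangle\phi$ iff $\exists X',e$: $X'\xrightarrow{e}X$, $\rho(x)=e$, $\rho$ permissible for $\phi$ and $X'$, $X',\rho\models\phi$. For closed $\phi$: $\mathcal C\models\phi$ iff $\emptyset,\emptyset\models\phi$. Modal depth: $d(\mathrm{tt})=0$, $d(\neg\phi)=d((x:a)\phi)=d(\phi)$, $d(\phi\wedge\phi')=\max(d(\phi),d(\phi'))$, $d(\langle x:a\rangle\phi)=d(\langle\!\langle x\rangle\!\rangle\phi)=1+d(\phi)$. *)

(* Defs.v *)
From HB Require Import structures.
From mathcomp Require Import all_boot finmap.
From mathcomp Require Import boolp classical_sets functions cardinality.

Set Implicit Arguments.
Unset Strict Implicit.
Unset Printing Implicit Defensive.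

Local Open Scope classical_set_scope.
Local Open Scope fset_scope.

(* The type [event] is exactly the union of the configurations, by            *)
(* [event_cover], so that a total [label] is a labelling of that union.       *)
Record conf_struct (Act : Type) := ConfStruct {
  event : choiceType;
  conf : set {fset event};
  label : event -> Act;
  event_cover : forall e, exists2 X, conf X & e \in X }.

Arguments conf {Act} C X : rename.

Section ConfigurationStructures.
Variables (Act : Type) (C : conf_struct Act).
Implicit Types (X Y Z : {fset event C}) (d e : event C) (a : Act).

Definition finite_cs : Prop := finite_set (conf C).

Record stable_cs : Prop := StableCs {
  stable_empty : conf C fset0;
  stable_connected : forall X, conf C X -> X != fset0 ->
    exists2 e, e \in X & conf C (X `\ e);
  stable_bounded : forall X Y Z, conf C X -> conf C Y -> conf C Z ->
    X `|` Y `<=` Z -> conf C (X `|` Y) /\ conf C (X `&` Y) }.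

(* Only meaningful for [conf C X] and [d], [e] in [X].                        *)
Definition causal_le X d e : Prop :=
  forall Y, conf C Y -> Y `<=` X -> e \in Y -> d \in Y.

Definition causal_lt X d e : Prop := causal_le X d e /\ d <> e.

Definition estep X e X' : Prop :=
  [/\ conf C X, conf C X', X `<=` X' & X' `\` X = [fset e]].

Definition step X a X' : Prop := exists2 e, estep X e X' & label e = a.

(* For infinite [C] this is the junk value 0.                                 *)
Definition max_conf_size : nat := \max_(X <- fset_set (conf C)) #|` X|.

End ConfigurationStructures.

Section Isomorphisms.
Variables (Act : Type) (C D : conf_struct Act).
Implicit Types (X : {fset event C}) (Y : {fset event D}).
Implicit Types f : set (event C * event D).

(* Functions between configurations are represented by their graphs.          *)
Record conf_iso X Y f : Prop := ConfIso {
  iso_sub : forall d e, f (d, e) -> d \in X /\ e \in Y;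
  iso_fun : forall d, d \in X -> exists! e, f (d, e);
  iso_bij : forall e, e \in Y -> exists! d, f (d, e);
  iso_label : forall d e, f (d, e) -> label d = label e;
  iso_lt : forall d d' e e', f (d, e) -> f (d', e') ->
    (causal_lt X d d' <-> causal_lt Y e e') }.

Definition restrict f X : set (event C * event D) :=
  [set p | f p /\ p.1 \in X].

Definition iso_triples :
    set ({fset event C} * {fset event D} * set (event C * event D)) :=
  [set t | [/\ conf C t.1.1, conf D t.1.2 & conf_iso t.1.1 t.1.2 t.2]].

(* [fset_set] returns the empty set on infinite sets, but [iso_triples] is    *)
(* finite when [C] and [D] are.                                               *)
Definition iso_count : nat := #|` fset_set iso_triples|.

Definition min_conf_size : nat := minn (max_conf_size C) (max_conf_size D).

Record HH_bisimulation
    (R : {fset event C} -> {fset event D} -> set (event C * event D) -> Prop) :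
    Prop := HHBisimulation {
  HH_conf : forall X Y f, R X Y f -> conf C X /\ conf D Y;
  HH_init : R fset0 fset0 set0;
  HH_iso : forall X Y f, R X Y f -> conf_iso X Y f;
  HH_fwd_l : forall X Y f a X', R X Y f -> step X a X' ->
    exists Y' f', [/\ step Y a Y', R X' Y' f' & restrict f' X = f];
  HH_fwd_r : forall X Y f a Y', R X Y f -> step Y a Y' ->
    exists X' f', [/\ step X a X', R X' Y' f' & restrict f' X = f];
  HH_bwd_l : forall X Y f a X', R X Y f -> step X' a X ->
    exists Y' f', [/\ step Y' a Y, R X' Y' f' & restrict f X' = f'];
  HH_bwd_r : forall X Y f a Y', R X Y f -> step Y' a Y ->
    exists X' f', [/\ step X' a X, R X' Y' f' & restrict f X' = f'] }.

Definition HH_bisimilar : Prop := exists R, HH_bisimulation R.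

End Isomorphisms.

Definition ident := nat.

Inductive formula (Act : Type) : Type :=
| Tt
| Neg of formula Act
| And of formula Act & formula Act
| Dia of ident & Act & formula Act       (* <x : a> phi *)
| Decl of ident & Act & formula Act      (* (x : a) phi *)
| RevDia of ident & formula Act.         (* <<x>> phi   *)

Arguments Tt {Act}.

Section EIL.
Variable Act : Type.
Implicit Types (phi : formula Act) (x : ident) (a : Act).

Fixpoint fi phi : {fset ident} :=
  match phi with
  | Tt => fset0
  | Neg phi => fi phi
  | And phi psi => fi phi `|` fi psi
  | Dia x _ phi => fi phi `\ x
  | Decl x _ phi => fi phi `\ x
  | RevDia x phi => x |` fi phi
  end.

Definition closed_formula phi : Prop := fi phi = fset0.

Fixpoint depth phi : nat :=
  match phi with
  | Tt => 0
  | Neg phi => depth phi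
  | And phi psi => maxn (depth phi) (depth psi)
  | Dia _ _ phi => (depth phi).+1
  | Decl _ _ phi => depth phi
  | RevDia _ phi => (depth phi).+1
  end.

Variable C : conf_struct Act.

Definition env := ident -> option (event C).

Definition env0 : env := fun=> None.

Definition upd (rho : env) x (e : event C) : env :=
  fun y => if y == x then Some e else rho y.

Definition permissible (rho : env) phi (X : {fset event C}) : Prop :=
  forall x, x \in fi phi -> exists2 e, rho x = Some e & e \in X.

(* Only meaningful when [rho] is permissible for [phi] and [X].               *)
Fixpoint sat (X : {fset event C}) (rho : env) phi : Prop :=
  match phi with
  | Tt => True
  | Neg phi => ~ sat X rho phi
  | And phi psi => sat X rho phi /\ sat X rho psi
  | Dia x a phi =>
      exists X' e, [/\ estep X e X', label e = a & sat X' (upd rho x e) phi]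
  | Decl x a phi =>
      exists e, [/\ e \in X, label e = a & sat X (upd rho x e) phi]
  | RevDia x phi =>
      exists X' e, [/\ estep X' e X, rho x = Some e,
                       permissible rho phi X' & sat X' rho phi]
  end.

Definition models phi : Prop := sat fset0 env0 phi.

End EIL.

(* Main.v *)
(*
For the "only if" direction, if a bisimulation relates [X] and [Y] by [f], and
two environments are related pointwise by [f], then they satisfy the same
formulas.

For the "if" direction, let [c = c(C, D)] and let [T n] be the set of triples
[(X, Y, f)] with [f] a bijection, presented by naming the events of [X] and [Y]
with common identifiers, such that [X] and [Y] satisfy the same formulas of
depth at most [n + c] in these names. The depth [c] is enough to force [f] to be
an isomorphism: if [d] does not precede [e] in [X], then some sequence of at
most [c] reverse steps removes [d] but not [e]. Each transition lets a triple of
[T (n+1)] move to a triple of [T n]: otherwise the finitely many candidate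
answers would be excluded by a conjunction of formulas of depth [n + c] placed
under one modality. The [T n] decrease inside a set of [s(C, D)] triples, so
[T n = T (n+1)] for some [n <= s(C, D)]; this [T n] is an HH bisimulation, and
it contains the initial triple by hypothesis.
*)
From mathcomp Require Import all_boot finmap.
From mathcomp Require Import boolp classical_sets cardinality.
Require Import Defs.

Set Implicit Arguments.
Unset Strict Implicit.
Unset Printing Implicit Defensive.

Local Open Scope classical_set_scope.
Local Open Scope fset_scope.

(** * Transitions and the meaning of formulas in one structure *)

Section OneStructure.
Variables (Act : Type) (C : conf_struct Act).
Implicit Types (X Y Z : {fset event C}) (d e : event C) (rho sg : env C).
Implicit Types (phi : formula Act) (x y : ident).

Lemma estepP X e X' :
  estep X e X' <-> [/\ conf C X, conf C X', e \notin X & X' = e |` X].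
Proof.
split=> [[cX cX' sX eX]|[cX + eX eX']].
  have: e \in X' `\` X by rewrite eX in_fset1.
  rewrite in_fsetD => /andP[-> _]; split=> //.
  apply/fsetP=> d; have /fsetP/(_ d) := eX; rewrite !inE => <-.
  by case dX: (d \in X); rewrite ?orbF// (fsubsetP sX _ dX).
rewrite eX' => cX'; split=> //; first exact: fsubsetUr.
apply/fsetP=> d; rewrite !inE.
by have [->|] := eqVneq d e; rewrite ?eX //= ?andNb.
Qed.

Lemma sat_ext phi X rho sg : (forall x, x \in fi phi -> rho x = sg x) ->
  sat X rho phi <-> sat X sg phi.
Proof.
elim: phi X rho sg => [|phi IH|phi IH psi IH'|x a phi IH|x a phi IH|x phi IH]
  X rho sg ext //=.
- by split=> H /(IH _ _ _ ext).
- have [e1 e2] : (forall x, x \in fi phi -> rho x = sg x) /\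
    (forall x, x \in fi psi -> rho x = sg x).
    by split=> x xf; apply: ext; rewrite /= in_fsetU xf ?orbT.
  by rewrite (propext (IH X _ _ e1)) (propext (IH' X _ _ e2)).
- have ext' e y : y \in fi phi -> upd rho x e y = upd sg x e y.
    by rewrite /upd; case: eqVneq => // yx yf; apply: ext; rewrite !inE yx.
  by split=> -[X' [e [? ? H]]]; exists X', e; split=> //;
    apply/(IH X' (upd rho x e) (upd sg x e) (ext' e)).
- have ext' e y : y \in fi phi -> upd rho x e y = upd sg x e y.
    by rewrite /upd; case: eqVneq => // yx yf; apply: ext; rewrite !inE yx.
  by split=> -[e [? ? H]]; exists e; split=> //;
    apply/(IH X (upd rho x e) (upd sg x e) (ext' e)).
- have ext' y : y \in fi phi -> rho y = sg y.
    by move=> yf; apply: ext; rewrite /= !inE yf orbT.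
  have extx : rho x = sg x by apply: ext; rewrite /= !inE eqxx.
  split=> -[X' [e [st xe per H]]]; exists X', e; split=> //.
  + by rewrite -extx.
  + by move=> y yf; rewrite -ext'//; apply: per.
  + exact/(IH _ _ _ ext').
  + by rewrite extx.
  + by move=> y yf; rewrite ext'//; apply: per.
  + exact/(IH _ _ _ ext').
Qed.

(* If the event [e] of [Y] removed by connectedness lies in [Z], remove [d]   *)
(* from [Y `\ e] relative to [Z `\ e] and add [e] back: [Y `\ d] is the union *)
(* of [Z] and [Y `\ e `\ d], which are bounded by [Y].                        *)
Lemma stable_remove (stC : stable_cs C) Y Z : conf C Y -> conf C Z ->
  Z `<` Y -> exists2 e, e \in Y `\` Z & conf C (Y `\ e).
Proof.
have [n] := ubnP #|` Y|; elim: n Y Z => // n IH Y Z.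
rewrite ltnS => leYn cY cZ ltZY; have sZY := fproper_sub ltZY.
have /fset0Pn[u] : Y `\` Z != fset0 by rewrite fsetD_eq0; case/andP: ltZY.
rewrite in_fsetD => /andP[uZ uY].
have [|e eY cYe] := stable_connected stC cY; first by apply/fset0Pn; exists u.
have [eZ|eZ] := boolP (e \in Z); last by exists e => //; rewrite in_fsetD eZ.
have ue : u != e by apply: contraNneq uZ => ->.
have [_ cZe] : conf C (Z `|` Y `\ e) /\ conf C (Z `&` (Y `\ e)).
  by apply: (stable_bounded stC cZ cYe cY); rewrite fsubUset sZY fsubD1set.
have [||d] := IH _ _ _ cYe cZe.
- by apply: leq_trans leYn; rewrite [in leqRHS](cardfsD1 e) eY.
- rewrite fproperEneq fsubsetIr andbT; apply/eqP => /fsetP/(_ u).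
  by rewrite !inE (negPf uZ) ue uY.
rewrite !inE => /andP[dN /andP[de dY]] cYed.
have dZ : d \notin Z by move: dN; rewrite de dY !andbT.
have [cU _] : conf C (Z `|` Y `\ e `\ d) /\ conf C (Z `&` (Y `\ e `\ d)).
  apply: (stable_bounded stC cZ cYed cY).
  by rewrite fsubUset sZY; apply/fsubsetP => v; rewrite !inE => /and3P[].
exists d; first by rewrite !inE dZ dY.
suff -> : Y `\ d = Z `|` Y `\ e `\ d by [].
apply/fsetP => v; rewrite !inE.
have [->|vd] := eqVneq v d; first by rewrite (negPf dZ).
have [->|ve] := eqVneq v e; first by rewrite eZ eY.
by rewrite /= orb_idl// => /(fsubsetP sZY).
Qed.

(** * Chains of reverse steps, and environments naming the events of a configuration *)

Definition rev_chain (xs : seq ident) : formula Act :=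
  foldr (@RevDia Act) Tt xs.

Lemma depth_rev_chain xs : depth (rev_chain xs) = size xs.
Proof. by elim: xs => //= x xs ->. Qed.

Lemma fi_rev_chain xs : fi (rev_chain xs) =i xs.
Proof. by elim: xs => //= x xs IH y; rewrite !inE IH. Qed.

(** Each [RevDia x] undoes exactly the event named by [x], so following the chain strips [X] of the
    named events and of nothing else. *)
Lemma sat_rev_chain xs X rho : conf C X -> sat X rho (rev_chain xs) ->
  exists2 Z, conf C Z & Z `<=` X /\
    forall d, d \in X -> d \notin Z <-> exists2 x, x \in xs & rho x = Some d.
Proof.
elim: xs X => [|x xs IH] X cX /=.
  by exists X => //; split=> // d ->; split=> // -[].
move=> [X' [e [/estepP[cX' _ eX' ->] xe _ /(IH _ cX')[Z cZ [sZ mZ]]]]].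
exists Z => //; split; first exact: fsubset_trans (fsubsetUr _ _).
move=> d; rewrite !inE => /orP[/eqP ->|dX'].
  split=> [_|_]; first by exists x; rewrite ?mem_head.
  by apply: contra eX' => /(fsubsetP sZ).
rewrite (mZ _ dX'); split=> -[y yxs yd]; exists y => //.
  by rewrite inE yxs orbT.
move: yxs; rewrite inE => /orP[/eqP yx|//].
by move: dX' eX'; rewrite yx xe in yd; case: yd => -> ->.
Qed.

(** [names_fresh] leaves an identifier for the next forward step and confines the names to an
    initial segment, where they can be counted. *)
Record names X rho : Prop := Names {
  names_fresh : exists N, forall x, N <= x -> rho x = None;
  names_in : forall x d, rho x = Some d -> d \in X;
  names_onto : forall d, d \in X -> exists x, rho x = Some d;
  names_inj : forall x y d, rho x = Some d -> rho y = Some d -> x = y }.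

Lemma names_upd X rho x e : names X rho -> rho x = None -> e \notin X ->
  names (e |` X) (upd rho x e).
Proof.
move=> [[N fr] rin onto inj] xN eX.
have new y d : upd rho x e y = Some d ->
    (y = x /\ d = e) \/ rho y = Some d /\ d != e.
  rewrite /upd; case: eqVneq => [-> [->]|_ yd]; [by left|right].
  by split=> //; apply: contraNneq eX => <-; apply: rin yd.
split.
- exists (maxn N x.+1) => y; rewrite geq_max => /andP[Ny xy].
  by rewrite /upd gtn_eqF // fr.
- by move=> y d; rewrite !inE => /new[[_ ->]|[/rin ->]]; rewrite ?eqxx ?orbT.
- move=> d; rewrite !inE => /orP[/eqP ->|/onto[y yd]].
    by exists x; rewrite /upd eqxx.
  by exists y; rewrite /upd; case: eqVneq => // yx; rewrite yx xN in yd.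
- move=> y z d /new[[-> ->]|[yd de]] /new[[-> E]|[zd E]] //.
  + by rewrite eqxx in E.
  + by rewrite E eqxx in de.
  + exact: inj yd zd.
Qed.

(** After a reverse step this forgets the name of the removed event, so that [names] persists. *)
Definition cut rho X : env C := fun x =>
  if rho x is Some d then if d \in X then Some d else None else None.

Lemma cutP rho X x d : cut rho X x = Some d <-> rho x = Some d /\ d \in X.
Proof.
rewrite /cut; case: (rho x) => [d'|]; last by split=> // -[].
case: ifP => d'X; split=> //.
- by move=> [<-].
- by move=> [].
- by move=> [[<-]]; rewrite d'X.
Qed.

Lemma names_cut X X' rho : names X rho -> X' `<=` X -> names X' (cut rho X').
Proof.
move=> [[N fr] rin onto inj] sX; split.
- by exists N => x Nx; rewrite /cut fr.
- by move=> x d /cutP[].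
- move=> d dX'; have [x xd] := onto d (fsubsetP sX _ dX').
  by exists x; apply/cutP.
- by move=> x y d /cutP[xd _] /cutP[yd _]; apply: inj xd yd.
Qed.

(** Repeated use of [stable_remove] peels off the events of [Y] outside [Z]; their names, in order
    of removal, form the chain. *)
Lemma sat_rev_chain_exists (stC : stable_cs C) rho Y Z :
  names Y rho -> conf C Y -> conf C Z -> Z `<=` Y -> exists2 xs, sat Y rho (rev_chain xs) &
  size xs <= #|` Y| /\
  forall x, x \in xs <-> exists2 d, rho x = Some d & d \in Y `\` Z.
Proof.
have [n] := ubnP #|` Y|; elim: n Y rho => // n IH Y rho.
rewrite ltnS => leYn nY cY cZ sZY.
have [->|neZY] := eqVneq Z Y; first exists [::] => //.
  by split=> // x; split=> // -[d _]; rewrite fsetDv.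
have [|e] := stable_remove stC cY cZ; first by rewrite fproperEneq neZY.
rewrite in_fsetD => /andP[eZ eY] cYe.
have [x xe] := names_onto nY eY.
have cardY : #|` Y| = #|` Y `\ e|.+1 by rewrite (cardfsD1 e) eY.
have sYe : Y `\ e `<=` Y := fsubD1set Y e.
have [||xs sxs [szxs mxs]] := IH (Y `\ e) _ _ (names_cut nY sYe) cYe cZ.
- by rewrite -cardY.
- apply/fsubsetP=> d dZ; rewrite !inE (fsubsetP sZY)// andbT.
  by apply: contraNneq eZ => <-.
exists (x :: xs).
  exists (Y `\ e), e; split=> //.
  - by apply/estepP; split=> //; rewrite ?fsetD1K// !inE eqxx.
  - move=> y; rewrite fi_rev_chain => /mxs[d /cutP[yd dY] _].
    by exists d.
  (* The rest of the chain names only events other than [e], so cutting the environment does not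
     affect it. *)
  - have eq_cut y : y \in fi (rev_chain xs) -> rho y = cut rho (Y `\ e) y.
      rewrite fi_rev_chain => /mxs[d yd _].
      by rewrite yd; case/cutP: yd.
    exact/(sat_ext _ eq_cut).
rewrite /= cardY ltnS szxs; split=> // y; rewrite inE; split.
  move=> /orP[/eqP ->|/mxs[d /cutP[yd dY] dZ]].
    by exists e; rewrite // in_fsetD eZ.
  exists d => //.
  by move: dZ; rewrite !inE => /and3P[-> _ ->].
move=> [d yd]; rewrite !inE => /andP[dZ dY].
have [de|de] := eqVneq d e.
  by rewrite (names_inj nY yd (_ : rho x = Some d)) ?eqxx ?de.
apply/orP; right; apply/mxs; exists d; last by rewrite !inE dZ de.
by apply/cutP; rewrite !inE de.
Qed.

(** The count depends only on the domain of [rho], so environments with equal domains name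
    configurations of equal size. *)
Lemma names_card X rho : names X rho -> exists N, forall n, N <= n ->
  #|` X| = count rho (iota 0 n).
Proof.
move=> [[N fr] rin onto inj]; exists N => n Nn.
have [g gP] : {g & forall d x, rho x = Some d -> x = g d}.
  apply: (@choice _ _ (fun d y => forall x, rho x = Some d -> x = y)) => d.
  have [[x xd]|no] := pselect (exists x, rho x = Some d).
    by exists x => y yd; apply: inj yd xd.
  by exists 0 => x xd; case: no; exists x.
have uniq_pmap : uniq (pmap rho (iota 0 n)).
  apply: (@pmap_uniq _ _ rho g); last exact: iota_uniq.
  by move=> x; case xd: (rho x) => [d|] //=; rewrite -(gP _ _ xd).
rewrite -size_pmap; apply/perm_size/uniq_perm => // d.
rewrite mem_pmap; apply/idP/mapP => [/onto[x xd]|[x _ /esym/rin //]].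
exists x => //; rewrite mem_iota /= add0n.
by rewrite ltnNge; apply/negP => nx; rewrite fr ?(leq_trans Nn) in xd.
Qed.

End OneStructure.

(** * Bisimilar structures satisfy the same formulas *)

Section Bisimilarity.
Variables (Act : Type) (C D : conf_struct Act).
Implicit Types (X : {fset event C}) (Y : {fset event D}).
Implicit Types (d : event C) (e : event D).
Implicit Types (f : set (event C * event D)) (phi : formula Act) (x : ident).

Lemma iso_fun_eq X Y f d e e' :
  conf_iso X Y f -> f (d, e) -> f (d, e') -> e = e'.
Proof.
move=> isof fde fde'; have [dX _] := iso_sub isof fde.
by have [e0 [_ uniq_e]] := iso_fun isof dX; rewrite -(uniq_e _ fde) (uniq_e _ fde').
Qed.

Lemma iso_inj X Y f d d' e : conf_iso X Y f -> f (d, e) -> f (d', e) -> d = d'.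
Proof.
move=> isof fde fde'; have [_ eY] := iso_sub isof fde.
by have [d0 [_ uniq_d]] := iso_bij isof eY; rewrite -(uniq_d _ fde) (uniq_d _ fde').
Qed.

(** If the partner of [d] under [f'] lay in [Y], surjectivity of [f] would give it a second
    preimage, in [X], against injectivity of [f']. *)
Lemma restrict_step X Y f d X' e Y' f' : conf_iso X Y f -> conf_iso X' Y' f' ->
  restrict f' X = f -> estep X d X' -> estep Y e Y' -> f' (d, e).
Proof.
move=> isof isof' ff' /estepP[_ _ dX eX'] /estepP[_ _ eY eY'].
have [|e' [fde' _]] := iso_fun isof' (_ : d \in X'); first by rewrite eX' !inE eqxx.
have [_] := iso_sub isof' fde'; rewrite eY' !inE => /orP[/eqP <-//|e'Y].
have [d' [fd'e' _]] := iso_bij isof e'Y.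
have [d'X _] := iso_sub isof fd'e'.
move: fd'e'; rewrite -ff' => -[/= fd'e' _].
by move: dX; rewrite (iso_inj isof' fde' fd'e') d'X.
Qed.

(** The restricted graph maps into [Y'] and onto it. This carries permissibility across a reverse
    step. *)
Lemma restrict_mem X Y f X' Y' d e : conf_iso X Y f ->
  conf_iso X' Y' (restrict f X') -> f (d, e) -> d \in X' <-> e \in Y'.
Proof.
move=> isof isof' fde; split=> [dX'|eY'].
  by have [] := iso_sub isof' (conj fde dX' : restrict f X' (d, e)).
have [d' [[/= fd'e d'X'] _]] := iso_bij isof' eY'.
by rewrite (iso_inj isof fde fd'e).
Qed.

Lemma HH_sat R X Y f phi (rho : env C) (sg : env D) : HH_bisimulation R ->
  R X Y f ->
  (forall x, x \in fi phi ->
     exists d e, [/\ rho x = Some d, sg x = Some e & f (d, e)]) ->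
  sat X rho phi <-> sat Y sg phi.
Proof.
move=> bisR.
elim: phi X Y f rho sg => [|phi IH|phi IH psi IH'|x a phi IH|x a phi IH|x phi IH]
  X Y f rho sg RXY rel //=.
- by split=> H /(IH _ _ _ _ _ RXY rel).
- have [r1 r2] : (forall x, x \in fi phi ->
       exists d e, [/\ rho x = Some d, sg x = Some e & f (d, e)]) /\
     (forall x, x \in fi psi ->
       exists d e, [/\ rho x = Some d, sg x = Some e & f (d, e)]).
    by split=> x xf; apply: rel; rewrite /= in_fsetU xf ?orbT.
  by rewrite (propext (IH _ _ _ _ _ RXY r1)) (propext (IH' _ _ _ _ _ RXY r2)).
- have isof := HH_iso bisR RXY.
  have upd_rel d e X' Y' f' : estep X d X' -> estep Y e Y' -> R X' Y' f' ->
      restrict f' X = f -> sat X' (upd rho x d) phi <-> sat Y' (upd sg x e) phi.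
    move=> st st' RX'Y' ff'; apply: (IH _ _ _ _ _ RX'Y') => y yf.
    rewrite /upd; have [_|yx] := eqVneq y x.
      exists d, e; split=> //.
      exact: restrict_step isof (HH_iso bisR RX'Y') ff' st st'.
    have [|d' [e' [yd' ye']]] := rel y; first by rewrite /= !inE yx.
    by rewrite -ff' => -[fde' _]; exists d', e'.
  split=> -[Z [u [st lu H]]].
    have [Y' [f' [[e st' le] RX' ff']]] :=
      HH_fwd_l bisR RXY (ex_intro2 _ _ u st lu).
    by exists Y', e; split=> //; apply/(upd_rel _ _ _ _ _ st st' RX' ff').
  have [X' [f' [[d st' ld] RX' ff']]] :=
    HH_fwd_r bisR RXY (ex_intro2 _ _ u st lu).
  by exists X', d; split=> //; apply/(upd_rel _ _ _ _ _ st' st RX' ff').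
- have isof := HH_iso bisR RXY.
  have upd_rel d e : f (d, e) ->
      sat X (upd rho x d) phi <-> sat Y (upd sg x e) phi.
    move=> fde; apply: (IH _ _ _ _ _ RXY) => y yf.
    rewrite /upd; have [_|yx] := eqVneq y x; first by exists d, e.
    by apply: rel; rewrite /= !inE yx.
  split=> -[u [uX lu H]].
    have [e [fde _]] := iso_fun isof uX; exists e; split.
    + by have [] := iso_sub isof fde.
    + by rewrite -(iso_label isof fde).
    + exact/(upd_rel _ _ fde).
  have [d [fde _]] := iso_bij isof uX; exists d; split.
  + by have [] := iso_sub isof fde.
  + by rewrite (iso_label isof fde).
  + exact/(upd_rel _ _ fde).
- have isof := HH_iso bisR RXY.
  have [|dx [ex [xdx xex fx]]] := rel x; first by rewrite /= !inE eqxx.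
  have {}rel y : y \in fi phi ->
      exists d e, [/\ rho y = Some d, sg y = Some e & f (d, e)].
    by move=> yf; apply: rel; rewrite /= !inE yf orbT.
  (* Permissibility on either side suffices, so that [back] serves both directions. *)
  have back d e X' Y' : estep X' d X -> estep Y' e Y -> R X' Y' (restrict f X') ->
      permissible rho phi X' \/ permissible sg phi Y' ->
      [/\ f (d, e), permissible rho phi X', permissible sg phi Y' &
          sat X' rho phi <-> sat Y' sg phi].
    move=> st st' RX'Y' per; have isof' := HH_iso bisR RX'Y'.
    have pX : permissible rho phi X'.
      case: per => [//|per] y yf; have [d' [e' [yd' ye' fde']]] := rel _ yf.
      exists d' => //; apply/(restrict_mem isof isof' fde').
      by have [e''] := per _ yf; rewrite ye' => -[->].
    split=> //.
    + exact: restrict_step isof' isof erefl st st'.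
    + move=> y yf; have [d' [e' [yd' ye' fde']]] := rel _ yf.
      exists e' => //; apply/(restrict_mem isof isof' fde').
      by have [d''] := pX _ yf; rewrite yd' => -[->].
    + apply: (IH _ _ _ _ _ RX'Y') => y yf; have [d' [e' [yd' ye' fde']]] := rel _ yf.
      exists d', e'; split=> //; split=> //=.
      by have [d''] := pX _ yf; rewrite yd' => -[->].
  split=> -[Z [u [st xu per H]]].
    have [Y' [f' [[e st' _] RX' ff']]] :=
      HH_bwd_l bisR RXY (ex_intro2 _ _ u st erefl).
    rewrite -ff' in RX'.
    have [fue _ pY E] := back _ _ _ _ st st' RX' (or_introl per).
    exists Y', e; split=> //; last exact/E.
    (* The event [e] undone in [Y] is the [f]-partner of [u], hence the one that [sg] assigns to
       [x]. *)
    by move: fx; rewrite xu in xdx; case: xdx => <- /(iso_fun_eq isof fue) ->.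
  have [X' [f' [[d st' _] RX' ff']]] :=
    HH_bwd_r bisR RXY (ex_intro2 _ _ u st erefl).
  rewrite -ff' in RX'.
  have [fdu pX _ E] := back _ _ _ _ st' st RX' (or_intror per).
  exists X', d; split=> //; last exact/E.
  by move: fx; rewrite xu in xex; case: xex => <- /(iso_inj isof fdu) ->.
Qed.

End Bisimilarity.

(** * Agreement of named configurations and its transfer along transitions *)

Section Agreement.
Variable Act : Type.
Implicit Types (C D : conf_struct Act) (phi : formula Act) (x : ident).

(* The environments [rho] and [sg] encode the bijection [graph rho sg]. All   *)
(* formulas share these names, so that formulas separating [X] from several   *)
(* [Y] can be conjoined without renaming identifiers.                         *)
Record agree C D (m : nat) (X : {fset event C}) (Y : {fset event D})
    (rho : env C) (sg : env D) : Prop := Agree {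
  agree_confl : conf C X;
  agree_confr : conf D Y;
  agree_namesl : names X rho;
  agree_namesr : names Y sg;
  agree_dom : forall x, rho x = sg x :> bool;
  agree_label : forall x d e,
    rho x = Some d -> sg x = Some e -> label d = label e;
  agree_sat : forall phi, depth phi <= m -> (forall x, x \in fi phi -> rho x) ->
    sat X rho phi <-> sat Y sg phi }.

Definition graph C D (rho : env C) (sg : env D) : set (event C * event D) :=
  [set p | exists x, rho x = Some p.1 /\ sg x = Some p.2].

Lemma agree_sym C D m X Y rho sg :
  @agree C D m X Y rho sg -> @agree D C m Y X sg rho.
Proof.
case=> cX cY nX nY dom lab sats; split=> //.
- by move=> x d e xd xe; rewrite (lab _ _ _ xe xd).
- by move=> phi dphi domphi; rewrite sats// => x /domphi; rewrite dom.
Qed.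

Lemma agree_leq C D m n X Y rho sg : m <= n ->
  @agree C D n X Y rho sg -> agree m X Y rho sg.
Proof.
move=> mn [cX cY nX nY dom lab sats]; split=> // phi dphi.
by apply: sats; apply: leq_trans mn.
Qed.

Lemma some_dom C D (rho : env C) (sg : env D) x d :
  (forall x, rho x = sg x :> bool) -> rho x = Some d -> exists e, sg x = Some e.
Proof.
by move=> dom xd; have := dom x; rewrite xd; case: (sg x) => // e _; exists e.
Qed.

(** [P i] passes from either conjunct to [And], so the conjunction of the formulas found for single
    indices serves all of them, and its depth is only their maximum. *)
Lemma finite_separation C (I : eqType) (P : I -> formula Act -> Prop) X
    (rho : env C) m (r : seq I) :
  (forall i phi psi, P i phi \/ P i psi -> P i (And phi psi)) ->
  (forall i, i \in r -> exists phi,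
     [/\ depth phi <= m, forall x, x \in fi phi -> rho x, sat X rho phi
       & P i phi]) ->
  exists phi, [/\ depth phi <= m, forall x, x \in fi phi -> rho x, sat X rho phi
    & forall i, i \in r -> P i phi].
Proof.
move=> PA; elim: r => [|i r IH] H; first by exists Tt.
have [|phi [dphi fphi sphi Pphi]] := IH.
  by move=> j jr; apply: H; rewrite inE jr orbT.
have [psi [dpsi fpsi spsi Ppsi]] := H i (mem_head _ _).
exists (And phi psi); split=> //=.
- by rewrite geq_max dphi.
- by move=> x; rewrite in_fsetU => /orP[/fphi|/fpsi].
- move=> j; rewrite inE => /orP[/eqP ->|jr]; apply: PA; [by right|left].
  exact: Pphi.
Qed.

(** One fresh [x] names the new event in [X'] and in every candidate answer, so formulas separating
    [X'] from them can be conjoined under a single [Dia x], at depth [m.+1]. *)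
Lemma agree_fwd C D m X Y rho sg d X' (finD : finite_cs D) :
  @agree C D m.+1 X Y rho sg -> estep X d X' ->
  exists e Y' x, [/\ estep Y e Y', label e = label d, rho x = None &
    agree m X' Y' (upd rho x d) (upd sg x e)].
Proof.
move=> ag st; have [cX cX' dX eX'] := (estepP _ _ _).1 st.
have [cX0 cY nX nY dom lab sats] := ag.
have [[N fr] _ _ _] := nX.
set x := N; have xN : rho x = None by apply: fr.
have yN : sg x = None by have := dom x; rewrite xN; case: (sg x).
have upd_dom y e : upd rho x d y = upd sg x e y :> bool.
  by rewrite /upd; case: eqVneq => // _; apply: dom.
apply: contrapT => none.
pose cand Y' e := estep Y e Y' /\ label e = label d.
have bad Y' e : cand Y' e -> exists phi, [/\ depth phi <= m,
    forall y, y \in fi phi -> upd rho x d y, sat X' (upd rho x d) phi &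
    ~ sat Y' (upd sg x e) phi].
  move=> [st' led]; apply: contrapT => nophi; apply: none.
  have [_ cY' eY eY'] := (estepP _ _ _).1 st'.
  exists e, Y', x; split=> //; split=> //.
  - by rewrite eX'; apply: names_upd.
  - by rewrite eY'; apply: names_upd.
  - move=> y d' e'; rewrite /upd; case: eqVneq => [_ [<-] [<-]//|_].
    exact: lab.
  (* A formula true only on the side of [D] is negated, so that every separating formula holds at
     [X']. *)
  - move=> phi dphi fphi; split=> [sC|sD]; apply: contrapT => ns; apply: nophi.
      by exists phi.
    by exists (Neg phi); split=> //= /(_ sD).
(* The index is [Y'] alone, as it determines the added event. A configuration that is no candidate
   is excluded vacuously, by [Tt]. *)
pose P Y' phi := forall e, cand Y' e -> ~ sat Y' (upd sg x e) phi.
have PA Y' phi psi : P Y' phi \/ P Y' psi -> P Y' (And phi psi).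
  by case=> H e /H ns /= [].
have [|phi [dphi fphi sphi Pphi]] :=
  @finite_separation C _ P X' (upd rho x d) m (fset_set (conf D)) PA.
  move=> Y' _; have [[e ce]|nc] := pselect (exists e, cand Y' e); last first.
    by exists Tt; split=> // e ce; case: nc; exists e.
  have [phi [? ? ? ns]] := bad _ _ ce; exists phi; split=> // e' ce'.
  suff <- : e = e' by [].
  have [[[_ _ _ eY'] _] [[_ _ _ eY''] _]] := (ce, ce').
  by apply/fset1P; rewrite -eY'' eY' inE.
have : sat Y sg (Dia x (label d) phi).
  apply/sats => //=; last by exists X', d.
  move=> y; rewrite !inE => /andP[yx yf].
  by have := fphi _ yf; rewrite /upd (negPf yx).
move=> [Y' [e [st' led sphi']]]; apply: (Pphi Y' _ e) => //.
by rewrite in_fset_set// inE; case: st'.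
Qed.

(** Undoing the event named by [x] has one possible result on each side, so a formula of depth [m]
    there is tested by prefixing [RevDia x]. *)
Lemma agree_bwd C D m X Y rho sg d X' :
  @agree C D m.+1 X Y rho sg -> estep X' d X ->
  exists e Y', [/\ estep Y' e Y, label e = label d &
    agree m X' Y' (cut rho X') (cut sg Y')].
Proof.
move=> [cX0 cY nX nY dom lab sats] st; have [cX' cX dX' eX] :=
  (estepP _ _ _).1 st.
have [x xd] : exists x, rho x = Some d.
  by apply: (names_onto nX); rewrite eX !inE eqxx.
have [e xe] := some_dom dom xd.
(* The extra level of depth pays for this formula, so the event of [Y] named by [x] can be undone
   too. *)
have : sat Y sg (RevDia x Tt).
  apply/sats => //=; first by move=> y; rewrite !inE orbF => /eqP ->; rewrite xd.
  by exists X', d.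
move=> [Y' [e' [st' xe' _ _]]].
have ee' : e' = e by move: xe'; rewrite xe => -[].
rewrite {e' xe'}ee' in st'.
have [cY' _ eY' eY] := (estepP _ _ _).1 st'.
(* A name loses its event on both sides or on neither: only [x] does. *)
have mem y d' e' : rho y = Some d' -> sg y = Some e' -> (d' \in X') = (e' \in Y').
  move=> yd' ye'.
  have := names_in nX yd'; have := names_in nY ye'.
  rewrite eX eY !inE.
  have [E|ne] := eqVneq e' e.
    have yx : y = x by apply: (names_inj nY ye'); rewrite E.
    move: yd'; rewrite yx xd => -[<-].
    by rewrite (negPf dX') E (negPf eY').
  have [E|_ /= -> ->//] := eqVneq d' d.
  have yx : y = x by apply: (names_inj nX yd'); rewrite E.
  by move: ye' ne; rewrite yx xe => -[->]; rewrite eqxx.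
exists e, Y'; split=> //; first by rewrite (lab _ _ _ xd xe).
have sX : X' `<=` X by rewrite eX fsubsetUr.
have sY : Y' `<=` Y by rewrite eY fsubsetUr.
split=> //.
- exact: names_cut sX.
- exact: names_cut sY.
- move=> y; rewrite /cut; case yd': (rho y) => [d'|].
    have [e' ye'] := some_dom dom yd'; rewrite ye' (mem _ _ _ yd' ye').
    by case: ifP.
  by have := dom y; rewrite yd'; case: (sg y).
- by move=> y d' e' /cutP[yd' _] /cutP[ye' _]; apply: lab yd' ye'.
move=> phi dphi fphi.
have fphi2 y : y \in fi phi -> exists d' e',
    [/\ rho y = Some d', d' \in X', sg y = Some e' & e' \in Y'].
  move=> /fphi; case yd': (cut rho X' y) => [d'|] // _.
  have [rd' dX''] := (cutP _ _ _ _).1 yd'.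
  have [e' ye'] := some_dom dom rd'.
  by exists d', e'; split=> //; rewrite -(mem _ _ _ rd' ye').
have E1 : sat X' (cut rho X') phi <-> sat X' rho phi.
  apply: sat_ext => y /fphi2[d' [e' [yd' dX'' _ _]]].
  by rewrite yd'; apply/cutP.
have E2 : sat Y' (cut sg Y') phi <-> sat Y' sg phi.
  apply: sat_ext => y /fphi2[d' [e' [_ _ ye' eY'']]].
  by rewrite ye'; apply/cutP.
have pX : permissible rho phi X' by move=> y /fphi2[d' [e' [? ? _ _]]]; exists d'.
have pY : permissible sg phi Y' by move=> y /fphi2[d' [e' [_ _ ? ?]]]; exists e'.
have H : sat X rho (RevDia x phi) <-> sat Y sg (RevDia x phi).
  apply: sats => //= y; rewrite !inE => /orP[/eqP ->|]; first by rewrite xd.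
  by move=> /fphi2[d' [e' [-> ]]].
(* The configuration reached through [RevDia x] is determined by the named event, hence is the one
   chosen above. *)
rewrite E1 E2; split=> sphi.
- have /H[Y2 [e2 [st2 xe2 _ sphi2]]] : sat X rho (RevDia x phi) by exists X', d.
  suff <- : Y2 = Y' by [].
  move: xe2 st2; rewrite xe => -[<-] /estepP[_ _ eY2 EY2].
  by rewrite -(fsetU1K eY2) -EY2 eY fsetU1K.
- have /H[X2 [d2 [st2 xd2 _ sphi2]]] : sat Y sg (RevDia x phi) by exists Y', e.
  suff <- : X2 = X' by [].
  move: xd2 st2; rewrite xd => -[<-] /estepP[_ _ dX2 EX2].
  by rewrite -(fsetU1K dX2) -EX2 eX fsetU1K.
Qed.

(** * Agreement to sufficient depth yields an isomorphism *)

Lemma agree_card C D m X Y rho sg : @agree C D m X Y rho sg -> #|` X| = #|` Y|.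
Proof.
move=> ag; have [N HN] := names_card (agree_namesl ag).
have [M HM] := names_card (agree_namesr ag).
rewrite (HN (maxn N M)) ?leq_maxl// (HM (maxn N M)) ?leq_maxr//.
by apply: eq_count => x; apply: agree_dom ag x.
Qed.

(** A configuration inside [Y] with [e'] but not [e] gives a chain of reverse steps from [Y]. The
    chain also holds at [X], where it reaches a configuration with [d'] but not [d]. *)
Lemma agree_lt C D m X Y rho sg (x y : ident) d d' e e' (stD : stable_cs D) :
  @agree C D m X Y rho sg -> #|` Y| <= m ->
  rho x = Some d -> sg x = Some e -> rho y = Some d' -> sg y = Some e' ->
  causal_lt X d d' -> causal_lt Y e e'.
Proof.
move=> ag leYm xd xe yd' ye' [le_dd' ne_dd'].
have [cX cY nX nY _ _ sats] := ag.
split; last first.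
  move=> ee'; apply: ne_dd'; rewrite -ee' in ye'.
  by move: yd'; rewrite -(names_inj nY xe ye') xd => -[].
move=> Z cZ sZ e'Z; apply/negPn/negP => eZ.
have [xs sxs [szxs mxs]] := sat_rev_chain_exists stD nY cY cZ sZ.
have [|W cW [sW mW]] := sat_rev_chain cX (_ : sat X rho (rev_chain Act xs)).
  apply/sats => //; first by rewrite depth_rev_chain (leq_trans szxs).
  move=> z; rewrite fi_rev_chain (agree_dom ag) => /mxs[u zu _].
  by rewrite zu.
have : d' \in W.
  apply/negPn/negP => /(mW _ (names_in nX yd'))[z zxs zd'].
  have zy := names_inj nX zd' yd'.
  have [u] := (mxs z).1 zxs; rewrite zy ye' => -[<-].
  by rewrite in_fsetD e'Z.
move/(le_dd' _ cW sW); apply/negP/(mW _ (names_in nX xd)).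
exists x => //; apply/mxs; exists e => //.
by rewrite in_fsetD eZ (names_in nY xe).
Qed.

(** [agree_lt] gives one implication for causality and the mirrored agreement the other; the depth
    bound serves both since [X] and [Y] have equal size. *)
Lemma agree_iso C D m X Y rho sg (stC : stable_cs C) (stD : stable_cs D) :
  @agree C D m X Y rho sg -> #|` X| <= m -> conf_iso X Y (graph rho sg).
Proof.
move=> ag leXm; have ag' := agree_sym ag.
have leYm : #|` Y| <= m by rewrite -(agree_card ag).
have [cX cY nX nY dom lab _] := ag.
split=> [d e|d dX|e eY|d e|d d' e e'].
- by move=> [x [/= xd xe]]; rewrite (names_in nX xd) (names_in nY xe).
- have [x xd] := names_onto nX dX; have [e xe] := some_dom dom xd.
  exists e; split; first by exists x.
  move=> e' [y [/= yd ye']]; move: ye'; rewrite (names_inj nX yd xd) xe.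
  by case.
- have [x xe] := names_onto nY eY.
  have [d xd] := some_dom (agree_dom ag') xe.
  exists d; split; first by exists x.
  move=> d' [y [/= yd' ye]]; move: yd'; rewrite (names_inj nY ye xe) xd.
  by case.
- by move=> [x [/= xd xe]]; apply: lab xd xe.
- move=> [x [/= xd xe]] [y [/= yd' ye']]; split.
    exact: agree_lt stD ag leYm xd xe yd' ye'.
  exact: agree_lt stC ag' leXm xe xd ye' yd'.
Qed.

(** Freshness of [x] keeps the old pairs, and [d] outside [X] discards the new one. *)
Lemma restrict_graph_upd C D X (rho : env C) (sg : env D) x d e :
  names X rho -> rho x = None -> d \notin X ->
  restrict (graph (upd rho x d) (upd sg x e)) X = graph rho sg.
Proof.
move=> nX xN dX; apply/seteqP; split=> -[d' e'].
  move=> [[y [/=]]]; rewrite /upd; case: eqVneq => [_ [<-] _ /= dX'|_ yd' ye' _].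
    by rewrite dX' in dX.
  by exists y.
move=> [y [/= yd' ye']]; split; last by have := names_in nX yd'.
exists y => /=; rewrite /upd; case: eqVneq => // yx.
by rewrite yx xN in yd'.
Qed.

Lemma graph_cut C D (rho : env C) (sg : env D) X Y :
  (forall x, cut rho X x = cut sg Y x :> bool) ->
  graph (cut rho X) (cut sg Y) = restrict (graph rho sg) X.
Proof.
move=> dom; apply/seteqP; split=> -[d e] /=.
  by move=> [x [/= /cutP[xd dX] /cutP[xe _]]]; split=> //; exists x.
move=> [[x [/= xd xe]] dX]; exists x => /=.
have xd' : cut rho X x = Some d by apply/cutP.
split=> //; have [e' xe'] := some_dom dom xd'.
by move: (xe') => /cutP[]; rewrite xe => -[->].
Qed.

(** * Stationarity of decreasing sequences, and finiteness *)

Lemma decreasing_stationary (U : choiceType) (A : set U) (T : nat -> set U) :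
  finite_set A -> (T 0 `<=` A)%classic -> (forall n, T n.+1 `<=` T n)%classic ->
  exists2 n, n <= #|` fset_set A| & (T n `<=` T n.+1)%classic.
Proof.
move=> finA TA decT; apply: contrapT => nostat.
have TnA n : (T n `<=` A)%classic by elim: n => // n IH; apply: subset_trans IH.
have finT n : finite_set (T n) by apply: sub_finite_set finA.
(* Strict inclusions cost [T n] an element at each stage; at one more than the size of [A] the bound
   is absurd. *)
suff bound n : n <= #|` fset_set A|.+1 ->
    #|` fset_set (T n)| + n <= #|` fset_set A|.
  by have := bound _ (leqnn _); rewrite leqNgt addnS ltnS leq_addl.
elim: n => [_|n IH nA].
  by rewrite addn0; apply: fsubset_leq_card; rewrite -fset_set_sub.
apply: leq_trans (IH (ltnW nA)).
rewrite addnS -addSn leq_add2r; apply: fproper_ltn_card.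
rewrite fproperE; apply/andP; split; first by rewrite -fset_set_sub.
by apply/negP; rewrite -fset_set_sub// => sub; apply: nostat; exists n; rewrite // -ltnS.
Qed.

Lemma finite_events C : finite_cs C -> finite_set [set: event C].
Proof.
move=> finC; have := bigcup_finite finC (fun X _ => finite_fset X).
by apply: sub_finite_set => e _; have [X cX eX] := event_cover e; exists X.
Qed.

Lemma finite_iso_triples C D :
  finite_cs C -> finite_cs D -> finite_set (@iso_triples Act C D).
Proof.
move=> finC finD.
have finE : finite_set [set: event C * event D].
  by rewrite -setXTT; apply: finite_setX; apply: finite_events.
(* Graphs are arbitrary sets of pairs; over finitely many events each comes from a member of a
   finite powerset. *)
have finf : finite_set [set: set (event C * event D)].
  have := finite_image (fun F : {fset event C * event D} => [set` F])
    (finite_fset (fpowerset (fset_set [set: event C * event D]))).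
  apply: sub_finite_set => f _; have finf : finite_set f by apply: sub_finite_set finE.
  by exists (fset_set f); rewrite /= ?fset_setK// fpowersetE -fset_set_sub.
apply: sub_finite_set (finite_setX (finite_setX finC finD) finf).
by move=> [[X Y] f] [].
Qed.

Lemma leq_max_conf_size C X :
  finite_cs C -> conf C X -> #|` X| <= max_conf_size C.
Proof.
move=> finC cX; rewrite /max_conf_size.
by rewrite (big_rem X) ?leq_maxl//= in_fset_set// inE.
Qed.

Lemma names0 C : names fset0 (@env0 Act C).
Proof. by split=> //; exists 0. Qed.

End Agreement.

(** * HH bisimilarity characterised by formulas of bounded depth *)

Theorem theorem5 (Act : Type) (C D : conf_struct Act)
    (finC : finite_cs C) (stC : stable_cs C)
    (finD : finite_cs D) (stD : stable_cs D) :
  HH_bisimilar C D <->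
  (forall phi : formula Act, closed_formula phi ->
     depth phi <= iso_count C D + min_conf_size C D ->
     (models C phi <-> models D phi)).
Proof.
split=> [[R bisR] phi closed_phi _|same].
  apply: HH_sat bisR (HH_init bisR) _ => x.
  by rewrite closed_phi.
set c := min_conf_size C D.
pose T n : set ({fset event C} * {fset event D} * set (event C * event D)) :=
  [set t | exists rho sg, agree (n + c) t.1.1 t.1.2 rho sg /\ t.2 = graph rho sg].
(* Equal sizes bound [X] by both maxima, hence by their minimum [c]. *)
have card_c n X Y rho sg : @agree Act C D (n + c) X Y rho sg -> #|` X| <= n + c.
  move=> ag; apply: leq_trans (leq_addl _ _).
  rewrite /c /min_conf_size leq_min; apply/andP; split; last rewrite (agree_card ag).
    exact: leq_max_conf_size finC (agree_confl ag).
  exact: leq_max_conf_size finD (agree_confr ag).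
have isoT n X Y rho sg : @agree Act C D (n + c) X Y rho sg ->
    conf_iso X Y (graph rho sg).
  by move=> ag; apply: agree_iso stC stD ag (card_c _ _ _ _ _ ag).
have [|||n len statT] := @decreasing_stationary _ (@iso_triples Act C D) T.
- exact: finite_iso_triples.
- move=> [[X Y] f] [rho [sg [/= ag ->]]]; split=> /=.
  + exact: agree_confl ag.
  + exact: agree_confr ag.
  + exact: isoT ag.
- move=> k t [rho [sg [ag tg]]]; exists rho, sg; split=> //.
  by apply: agree_leq ag; rewrite leq_add2r.
(* Each transfer clause first lifts its triple to stage [n.+1] by [statT], then spends one level of
   depth to land in stage [n]. *)
exists (fun X Y f => T n (X, Y, f)); split.
- move=> X Y f [rho [sg [/= ag _]]].
  by split; [exact: agree_confl ag | exact: agree_confr ag].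
- exists (@env0 Act C), (@env0 Act D); split=> /=; last first.
    by apply/seteqP; split=> // p [x []].
  split=> //; [exact: stable_empty stC|exact: stable_empty stD|exact: names0..|].
  (* Under empty environments only closed formulas qualify, and the bound on [n] keeps their depth
     within the hypothesis. *)
  move=> phi dphi fphi; apply: same.
    by apply/fsetP => x; rewrite in_fset0; apply/negP => /fphi.
  by apply: leq_trans dphi _; rewrite leq_add2r.
- by move=> X Y f [rho [sg [/= ag ->]]]; apply: isoT ag.
- move=> X Y f a X' /statT[rho [sg [/= ag ->]]] [d st <-].
  have [e [Y' [x [st' led xN ag']]]] := agree_fwd finD ag st.
  exists Y', (graph (upd rho x d) (upd sg x e)); split.
  + by exists e.
  + by exists (upd rho x d), (upd sg x e).
  + apply: restrict_graph_upd xN _; first exact: agree_namesl ag.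
    by have [] := (estepP _ _ _).1 st.
- move=> X Y f a Y' /statT[rho [sg [/= ag ->]]] [e st <-].
  have [d [X' [x [st' led xN ag']]]] := agree_fwd finC (agree_sym ag) st.
  exists X', (graph (upd rho x d) (upd sg x e)); split.
  + by exists d.
  + by exists (upd rho x d), (upd sg x e); split=> //; apply: agree_sym.
  + apply: restrict_graph_upd; first exact: agree_namesl ag.
      by have := agree_dom ag x; rewrite xN; case: (rho x).
    by have [] := (estepP _ _ _).1 st'.
- move=> X Y f a X' /statT[rho [sg [/= ag ->]]] [d st <-].
  have [e [Y' [st' led ag']]] := agree_bwd ag st.
  exists Y', (graph (cut rho X') (cut sg Y')); split.
  + by exists e.
  + by exists (cut rho X'), (cut sg Y').
  + by rewrite graph_cut//; apply: agree_dom ag'.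
- move=> X Y f a Y' /statT[rho [sg [/= ag ->]]] [e st <-].
  have [d [X' [st' led /agree_sym ag']]] := agree_bwd (agree_sym ag) st.
  exists X', (graph (cut rho X') (cut sg Y')); split.
  + by exists d.
  + by exists (cut rho X'), (cut sg Y').
  + by rewrite graph_cut//; apply: agree_dom ag'.
Qed.
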